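(* Let $\mathcal{C}$ be a permutation class. If $\mathcal{C}$ is well-quasi-ordered (wqo) under the containment order, then its sum closure $\bigoplus\mathcal{C}$ and its skew closure $\mathop{\ominus}\mathcal{C}$ are also wqo. Likewise, if $\mathcal{C}$ is labelled well-quasi-ordered (lwqo), then $\bigoplus\mathcal{C}$ and $\mathop{\ominus}\mathcal{C}$ are also lwqo. (Here the prefix operator $\mathop{\ominus}$ denotes the skew-sum analogue of $\bigoplus$.)
   Context: A permutation of length $n$ is an arrangement $\pi=\pi(1)\cdots\pi(n)$ of $1,\dots,n$ (the empty permutation is allowed). The permutation $\sigma$ of length $k$ is contained in $\pi$ of length $n$, written $\sigma\le\pi$, if there are indices $1\le i_1<\cdots<i_k\le n$ such that $\pi(i_1)\cdots\pi(i_k)$ is order isomorphic to $\sigma$. A permutation class is a set of permutations closed downward under containment (so a nonempty class contains the empty permutation). For permutations $\sigma$ of length $m$ and $\tau$ of length $n$, the sum $\sigma\oplus\tau$ has length $m+n$ and is given by $(\sigma\oplus\tau)(i)=\sigma(i)$ for $1\le i\le m$ and $\tau(i-m)+m$ for $m+1\le i\le m+n$; the skew sum $\sigma\ominus\tau$ is given by $(\sigma\ominus\tau)(i)=\sigma(i)+n$ for $1\le i\le m$ and $\tau(i-m)$ for $m+1\le i\le m+n$. The sum closure $\bigoplus\mathcal{C}$ is the smallest permutation class containing $\mathcal{C}$ and closed under $\oplus$; equivalently $\bigoplus\mathcal{C}=\{\alpha_1\oplus\cdots\oplus\alpha_m : \alpha_1,\dots,\alpha_m\in\mathcal{C}\}$.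 The skew closure $\mathop{\ominus}\mathcal{C}$ is defined in the same way with the binary operation $\ominus$ in place of $\oplus$. A quasi-order $(Y,\le)$ is wqo if every infinite sequence $y_1,y_2,\dots$ in $Y$ has indices $i<j$ with $y_i\le y_j$. Given a quasi-order $(L,\le_L)$, an $L$-labelled permutation is a pair $(\pi,\ell_\pi)$ with $\pi$ a permutation of length $n$ and $\ell_\pi:\{1,\dots,n\}\to L$. We say $(\sigma,\ell_\sigma)\le(\pi,\ell_\pi)$, where $\sigma$ and $\pi$ have lengths $k$ and $n$, if there are indices $1\le i_1<\cdots<i_k\le n$ such that $\pi(i_1)\cdots\pi(i_k)$ is order isomorphic to $\sigma$ and $\ell_\sigma(j)\le_L\ell_\pi(i_j)$ for all $1\le j\le k$. For a set $X$ of permutations, $X\wr L$ is the set of all $L$-labelled members of $X$ under this order. The set $X$ is lwqo if $X\wr L$ is wqo for every wqo $(L,\le_L)$. *)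

(* Defs.v *)
From mathcomp Require Import all_boot all_fingroup.
From mathcomp Require Import classical_sets.
From Stdlib Require Import RelationClasses.

Set Implicit Arguments.
Unset Strict Implicit.
Unset Printing Implicit Defensive.

Local Open Scope classical_set_scope.

(** Positions and values range over ['I_n], i.e. 0, ..., n-1 instead of
    1, ..., n. *)
Definition permutation := {n : nat & 'S_n}.
Definition mkperm n (s : 'S_n) : permutation := existT (fun n => 'S_n) n s.
Definition plength (p : permutation) : nat := projT1 p.
Definition pperm (p : permutation) : 'S_(plength p) := projT2 p.

(** [f] lists the positions of an occurrence of [s] in [p]. *)
Definition embedding (s p : permutation)
    (f : 'I_(plength s) -> 'I_(plength p)) : Prop :=
  (forall i j : 'I_(plength s), i < j -> f i < f j) /\
  (forall i j : 'I_(plength s), (pperm s i < pperm s j) = (pperm p (f i) < pperm p (f j))).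

Definition contained (s p : permutation) : Prop :=
  exists f : 'I_(plength s) -> 'I_(plength p), embedding f.

Definition perm_class (C : set permutation) : Prop :=
  forall s p, contained s p -> C p -> C s.

Section Sums.
Variables (m n : nat) (s : 'S_m) (t : 'S_n).

Definition sum_fun (i : 'I_(m + n)) : 'I_(m + n) :=
  match split i with
  | inl a => lshift n (s a)
  | inr b => rshift m (t b)
  end.

(** Here [rshift n (s a)] has value [n + s a] and [lshift m (t b)] has value
    [t b]; both live in ['I_(n + m)]. *)
Definition skew_fun (i : 'I_(m + n)) : 'I_(m + n) :=
  cast_ord (addnC n m)
    match split i with
    | inl a => rshift n (s a)
    | inr b => lshift m (t b)
    end.

Lemma sum_fun_inj : injective sum_fun.
Proof.
move=> i j; rewrite /sum_fun.
case: (split_ordP i) => a ->; case: (split_ordP j) => b -> /eqP;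
  rewrite ?eq_lshift ?eq_rshift ?eq_lrshift ?eq_rlshift //;
  by move=> /eqP /perm_inj ->.
Qed.

Lemma skew_fun_inj : injective skew_fun.
Proof.
move=> i j /cast_ord_inj.
case: (split_ordP i) => a ->; case: (split_ordP j) => b -> /eqP;
  rewrite ?eq_lshift ?eq_rshift ?eq_lrshift ?eq_rlshift //;
  by move=> /eqP /perm_inj ->.
Qed.

End Sums.

Definition psum (s t : permutation) : permutation :=
  mkperm (perm (@sum_fun_inj _ _ (pperm s) (pperm t))).

Definition pskew (s t : permutation) : permutation :=
  mkperm (perm (@skew_fun_inj _ _ (pperm s) (pperm t))).

Definition closed_under (op : permutation -> permutation -> permutation)
    (D : set permutation) : Prop :=
  forall s t, D s -> D t -> D (op s t).

Definition sum_closure (C : set permutation) : set permutation :=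
  smallest [set D | perm_class D /\ closed_under psum D] C.

Definition skew_closure (C : set permutation) : set permutation :=
  smallest [set D | perm_class D /\ closed_under pskew D] C.

Definition wqo (Y : Type) (le : Y -> Y -> Prop) : Prop :=
  PreOrder le /\
  forall y : nat -> Y, exists i j : nat, i < j /\ le (y i) (y j).

Definition wqo_on (T : Type) (X : set T) (le : T -> T -> Prop) : Prop :=
  wqo (fun x y : {x : T | X x} => le (proj1_sig x) (proj1_sig y)).

Record lperm (L : Type) := LPerm {
  lperm_perm : permutation;
  lperm_label : 'I_(plength lperm_perm) -> L
}.

Arguments lperm_label {L} p i : rename.

Definition lcontained (L : Type) (leL : L -> L -> Prop) (s p : lperm L) : Prop :=
  exists f : 'I_(plength (lperm_perm s)) -> 'I_(plength (lperm_perm p)),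
    embedding f /\ forall j, leL (lperm_label s j) (lperm_label p (f j)).

(** The set of all [L]-labelled members of [X]. *)
Definition labelled (X : set permutation) (L : Type) : set (lperm L) :=
  [set p | X (lperm_perm p)].

Arguments labelled X L : clear implicits.

Definition lwqo (X : set permutation) : Prop :=
  forall (L : Type) (leL : L -> L -> Prop),
    wqo leL -> wqo_on (labelled X L) (lcontained leL).

(* Main.v *)
(** A permutation contained in [a (+) b] splits as [s1 (+) s2] with [s1 <= a] and
    [s2 <= b], so the closure of a class consists of the iterated sums of its
    members.  Since [(+)] is monotone in both arguments and dominates each of
    them, also for labelled permutations, Higman's theorem for a single binary
    operation applies to the terms over the class: in a bad sequence of terms of
    pointwise minimal size, the leaves are eventually absent and the immediate
    subterms form no bad sequence, so two of the terms have comparable left and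
    right children.  The skew case is the same, and the unlabelled case is the
    one with a single label. *)

Require Import Defs.
From mathcomp Require Import all_boot all_fingroup.
From mathcomp Require Import boolp classical_sets.
From mathcomp Require Import zify.
From Stdlib Require Import RelationClasses.

Set Implicit Arguments.
Unset Strict Implicit.
Unset Printing Implicit Defensive.

(** * Subsequences and minimal bad sequences *)

Definition increasing (phi : nat -> nat) : Prop :=
  forall m n, m < n -> phi m < phi n.

Definition good T (le : T -> T -> Prop) (y : nat -> T) : Prop :=
  exists i j : nat, i < j /\ le (y i) (y j).

Lemma increasing_succ (phi : nat -> nat) :
  (forall n, phi n < phi n.+1) -> increasing phi.
Proof. by move=> h; exact: homo_ltn ltn_trans h. Qed.

Lemma subsequence_or_eventually_not (Q : nat -> Prop) :
  (exists phi, increasing phi /\ forall n, Q (phi n)) \/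
  exists N, forall n, N <= n -> ~ Q n.
Proof.
case: (pselect (forall N, exists n, N <= n /\ Q n)) => [/choice [f fP]|].
  left; pose phi := fix phi n := if n is k.+1 then f (phi k).+1 else f 0.
  exists phi; split; last by case=> [|n] /=; [case: (fP 0) | case: (fP (phi n).+1)].
  by apply: increasing_succ => n /=; case: (fP (phi n).+1).
move=> /existsNP [N hN]; right; exists N => n leNn Qn.
by apply: hN; exists n.
Qed.

(** Call a term terminal if no later term lies above it. Infinitely many terminal terms would form a
    subsequence that is not good; beyond the last one, a later larger term can be chosen again and
    again. Goodness is asked only of the subsequences of [y], since it will be known only for
    sequences of children. *)
Lemma ascending_subsequence T (le : T -> T -> Prop) (y : nat -> T) :
  (forall x1 x2 x3, le x1 x2 -> le x2 x3 -> le x1 x3) ->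
  (forall phi, increasing phi -> good le (y \o phi)) ->
  exists phi, increasing phi /\ forall i j, i < j -> le (y (phi i)) (y (phi j)).
Proof.
move=> le_trans y_good.
have [[phi [incr term]]|[N noterm]] := subsequence_or_eventually_not
    (fun n => forall m, n < m -> ~ le (y n) (y m)).
  have [i [j [lt_ij le_ij]]] := y_good phi incr.
  by case: (term i _ (incr _ _ lt_ij)).
(* The bound [N <= n] sits under the existential so that [choice] yields a total function; below [N]
   the value 0 is a dummy. *)
have step n : exists m, N <= n -> n < m /\ le (y n) (y m).
  case: (leqP N n) => [/noterm/existsNP [m /not_implyP [lt_nm /contrapT le_nm]]|_].
    by exists m.
  by exists 0.
have [f fP] := choice step.
pose phi n := iter n f N.
have geN n : N <= phi n.
  elim: n => //= n IH; case: (fP _ IH) => lt_n _.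
  exact: leq_trans IH (ltnW lt_n).
exists phi; split.
  by apply: increasing_succ => n; case: (fP _ (geN n)).
apply: (homo_ltn (r := fun a b => le (y a) (y b))) => [a b c|n].
  exact: le_trans.
by case: (fP _ (geN n)).
Qed.

(** Nash-Williams' construction: stage [n] replaces the current bad sequence by one that agrees with
    it before [n] and has the smallest possible size at [n]. *)
Lemma minimal_bad_sequence T (le : T -> T -> Prop) (size : T -> nat) (y : nat -> T) :
  ~ good le y ->
  exists g, ~ good le g /\
    forall n h, ~ good le h -> (forall i, i < n -> h i = g i) ->
      size (g n) <= size (h n).
Proof.
move=> bad_y.
have step (nf : nat * (nat -> T)) : exists f', ~ good le nf.2 ->
    [/\ ~ good le f', forall i, i < nf.1 -> f' i = nf.2 i &
      forall h, ~ good le h -> (forall i, i < nf.1 -> h i = nf.2 i) ->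
        size (f' nf.1) <= size (h nf.1)].
  case: nf => n f /=.
  case: (pselect (good le f)) => [gf|bf]; first by exists f.
  pose P k := `[< exists h, [/\ ~ good le h, forall i, i < n -> h i = f i
                             & size (h n) = k] >].
  have exP : exists k, P k by exists (size (f n)); apply/asboolP; exists f.
  case: (ex_minnP exP) => k /asboolP [f' [bf' eqf' <-]] minf'.
  exists f' => _; split=> // h bh eqh.
  by apply: minf'; apply/asboolP; exists h.
have [F FP] := choice step.
pose f := fix f n := if n is k.+1 then F (k, f k) else y.
have bad_f n : ~ good le (f n).
  by elim: n => //= n IH; case: (FP (n, f n) IH).
(* Entry [n] is settled at stage [n.+1] and never changes afterwards, so the diagonal agrees with
   [f n] below [n]; a good pair of [g] would be a good pair of some [f n]. *)
pose g n := f n.+1 n.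
have f_g n i : i < n -> f n i = g i.
  elim: n => // n IH; rewrite ltnS leq_eqVlt => /predU1P [->//|lt_in].
  by case: (FP (n, f n) (bad_f n)) => _ /(_ i lt_in) /= -> _; exact: IH.
exists g; split.
  move=> [i [j [lt_ij le_ij]]]; apply: (bad_f j.+1); exists i, j; split=> //.
  by rewrite !f_g // ltnW.
move=> n h bad_h eq_h; case: (FP (n, f n) (bad_f n)) => _ _ /=; apply=> // i lt_in.
by rewrite eq_h // f_g.
Qed.

(** * Terms and Higman's theorem for a binary operation *)

Inductive generated T (op : T -> T -> T) (G : set T) : T -> Prop :=
| generated_base x : G x -> generated op G x
| generated_op x y :
    generated op G x -> generated op G y -> generated op G (op x y).

(** Derivations of [generated] as data: a size can be computed from a term, but not from a proof in
    [Prop]. *)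
Inductive term T (G : set T) :=
| Leaf of {x | G x}
| Node of term G & term G.

Fixpoint term_size T (G : set T) (t : term G) : nat :=
  if t is Node l r then (term_size l + term_size r).+1 else 0.

Fixpoint eval T (op : T -> T -> T) (G : set T) (t : term G) : T :=
  match t with
  | Leaf x => proj1_sig x
  | Node l r => op (eval op l) (eval op r)
  end.

Definition child T (G : set T) (u t : term G) : Prop :=
  if t is Node l r then u = l \/ u = r else False.

Lemma child_size T (G : set T) (u t : term G) : child u t -> term_size u < term_size t.
Proof. by case: t => //= l r [->|->]; rewrite ltnS ?leq_addr ?leq_addl. Qed.

Lemma generatedP T (op : T -> T -> T) (G : set T) x :
  generated op G x -> exists t : term G, eval op t = x.
Proof.
elim=> {x} [x Gx|x y _ [t <-] _ [u <-]]; first by exists (Leaf (exist _ x Gx)).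
by exists (Node t u).
Qed.

Section BinaryHigman.
Variables (T : Type) (le : T -> T -> Prop) (op : T -> T -> T).
Hypothesis le_pre : PreOrder le.
Hypothesis op_mono : forall x x' y y', le x x' -> le y y' -> le (op x y) (op x' y').
Hypothesis op_gel : forall x y, le x (op x y).
Hypothesis op_ger : forall x y, le y (op x y).

Lemma le_child (G : set T) (u t : term G) : child u t -> le (eval op u) (eval op t).
Proof. by case: t => //= l r [->|->]. Qed.

Lemma wqo_terms (G : set T) : wqo_on G le ->
  forall y : nat -> term G, good (fun t u => le (eval op t) (eval op u)) y.
Proof.
move=> [_ wqoG] y; apply: contrapT => /minimal_bad_sequence.
set leT := fun t u => _; move=> /(_ (@term_size T G)) [g [bad_g min_g]].
have le_tr : forall x1 x2 x3, leT x1 x2 -> leT x2 x3 -> leT x1 x3.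
  by move=> x1 x2 x3; exact: (@PreOrder_Transitive _ le).
(* Splicing a bad sequence of children into [g] at the least parent index would
   contradict minimality. *)
have good_children (k : nat -> nat) (u : nat -> term G) :
    (forall i, child (u i) (g (k i))) -> good leT u.
  move=> uP; apply: contrapT => bad_u.
  have exk : exists m, `[< exists i, k i = m >].
    by exists (k 0); apply/asboolP; exists 0.
  (* [k] is arbitrary, so the least parent index [m] may be attained late; only the tail of [u] from
     [i0] on is spliced in. *)
  case: (ex_minnP exk) => m /asboolP [i0 ki0] min_m.
  have ge_m i : m <= k i by apply: min_m; apply/asboolP; exists i.
  pose h n := if n < m then g n else u (i0 + (n - m)).
  have : ~ good leT h.
    move=> [i [j [lt_ij]]]; rewrite /h.
    case: (ltnP i m) => [lt_im|le_mi]; case: (ltnP j m) => [lt_jm|le_mj] le_ij.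
    - by apply: bad_g; exists i, j.
    (* A child lies below its parent, whose index is at least [m > i]; this gives a good pair inside
       [g]. *)
    - apply: bad_g; exists i, (k (i0 + (j - m))); split.
        exact: leq_trans lt_im (ge_m _).
      exact: le_tr le_ij (le_child (uP _)).
    - by lia.
    - by apply: bad_u; exists (i0 + (i - m)), (i0 + (j - m)); split=> //; lia.
  move=> /(min_g m) le_size.
  have : term_size (g m) <= term_size (h m).
    by apply: le_size => i lt_im; rewrite /h lt_im.
  (* [h m] is [u i0], a child of [g m], hence strictly smaller. *)
  rewrite /h ltnn subnn addn0 leqNgt -ki0.
  by move/negP; apply; exact: child_size.
have [[phi [incr leaf]]|[N noleaf]] := subsequence_or_eventually_not
    (fun n => exists x, g n = Leaf x).
  have [x xP] := choice leaf.
  have [i [j [lt_ij le_ij]]] := wqoG x.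
  apply: bad_g; exists (phi i), (phi j); split; first exact: incr.
  by rewrite !xP.
have node n : exists lr, g (N + n) = Node lr.1 lr.2.
  have /noleaf : N <= N + n by exact: leq_addr.
  case: (g (N + n)) => [x|l r _]; last by exists (l, r).
  by case; exists x.
have [lr lrP] := choice node.
(* Left children ascend along some [phi]; two right children along the same [phi] are comparable, so
   both sides compare at once. *)
have [|phi [incr asc]] := @ascending_subsequence _ leT (fst \o lr) le_tr.
  move=> phi _; apply: (good_children (fun n => N + phi n)) => n /=.
  by rewrite lrP /=; left.
have [|i [j [lt_ij le_ij]]] :=
    good_children (fun n => N + phi n) (fun n => (lr (phi n)).2).
  by move=> n /=; rewrite lrP /=; right.
apply: bad_g; exists (N + phi i), (N + phi j); split.
  by rewrite ltn_add2l; exact: incr.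
by rewrite !lrP; apply: op_mono => //; exact: asc.
Qed.

Lemma preorder_on (X : set T) :
  PreOrder (fun x y : {x | X x} => le (proj1_sig x) (proj1_sig y)).
Proof.
split=> [x|x y z]; first exact: (@PreOrder_Reflexive _ le).
exact: (@PreOrder_Transitive _ le).
Qed.

Theorem wqo_generated (G D : set T) :
  (forall x, D x -> generated op G x) -> wqo_on G le -> wqo_on D le.
Proof.
move=> DG wqoG; split; first exact: preorder_on.
move=> y.
have [t tP] := choice (fun n => generatedP (DG _ (proj2_sig (y n)))).
have [i [j [lt_ij le_ij]]] := wqo_terms wqoG t.
by exists i, j; split=> //; move: le_ij; rewrite !tP.
Qed.

End BinaryHigman.

(** * Permutations and relative order *)

Lemma card_ord_lt n m : m <= n -> #|[set k : 'I_n | k < m]| = m.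
Proof.
move=> le_mn; rewrite -sum1dep_card -(big_ord_widen n (fun=> 1) le_mn).
by rewrite sum1_card card_ord.
Qed.

Lemma perm_rank n (s : 'S_n) i : #|[set j | s j < s i]| = s i.
Proof.
have -> : [set j | s j < s i] = s @^-1: [set k : 'I_n | k < s i].
  by apply/setP => j; rewrite !inE.
rewrite card_preimset; last exact: perm_inj.
by rewrite card_ord_lt // ltnW.
Qed.

(** Each value of a permutation is the number of smaller values, hence is determined by the
    comparisons. *)
Lemma order_isomorphic_perm_eq n (s t : 'S_n) :
  (forall i j, (s i < s j) = (t i < t j)) -> s = t.
Proof.
move=> st; apply/permP => i; apply: val_inj; rewrite /= -(perm_rank s) -(perm_rank t).
by congr #|pred_of_set _|; apply/setP => j; rewrite !inE st.
Qed.

(** The permutation sends [i] to the number of [j] with [v j < v i]. *)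
Lemma standardize n (v : 'I_n -> nat) : injective v ->
  exists s : 'S_n, forall i j, (s i < s j) = (v i < v j).
Proof.
move=> v_inj; pose below i := [set j | v j < v i].
have below_mono i j : v i < v j -> #|below i| < #|below j|.
  move=> lt_ij; apply/proper_card/properP; split.
    by apply/fintype.subsetP => k; rewrite !inE => /ltn_trans; apply.
  by exists i; rewrite !inE ?ltnn.
have below_lt i : #|below i| < n.
  rewrite -[X in _ < X]card_ord -cardsT; apply/proper_card/properP.
  by split; [exact: finset.subsetT | exists i; rewrite !inE ?ltnn].
pose f i := Ordinal (below_lt i).
have f_mono i j : (f i < f j) = (v i < v j).
  case: (ltngtP (v i) (v j)) => [/below_mono //|/below_mono lt_ji|/v_inj ->].
    by apply/negbTE; rewrite -leqNgt ltnW.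
  exact: ltnn.
have f_inj : injective f.
  move=> i j eq_f; apply: v_inj.
  have := f_mono i j; have := f_mono j i; rewrite eq_f ltnn.
  by case: ltngtP.
by exists (perm f_inj) => i j; rewrite !permE.
Qed.

(** * Sums and skew sums as block operations *)

Lemma split_lshift m n (i : 'I_m) : split (lshift n i) = inl i.
Proof. exact: (unsplitK (inl i)). Qed.

Lemma split_rshift m n (i : 'I_n) : split (rshift m i) = inr i.
Proof. exact: (unsplitK (inr i)). Qed.

(* [up = true] specifies sums, [up = false] skew sums. *)
Definition block_op (up : bool) (op : forall m n, 'S_m -> 'S_n -> 'S_(m + n)) :=
  forall m n (s : 'S_m) (t : 'S_n),
  [/\ forall i j, (op m n s t (lshift n i) < op m n s t (lshift n j)) = (s i < s j),
      forall i j, (op m n s t (rshift m i) < op m n s t (rshift m j)) = (t i < t j),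
      forall i j, (op m n s t (lshift n i) < op m n s t (rshift m j)) = up
    & forall i j, (op m n s t (rshift m j) < op m n s t (lshift n i)) = ~~ up].

Lemma block_op_sum : block_op true (fun m n s t => perm (@sum_fun_inj m n s t)).
Proof.
move=> m n s t; split=> i j; rewrite !permE /sum_fun;
  rewrite ?split_lshift ?split_rshift ?ltn_add2l //=.
  by rewrite ltn_addr.
by rewrite ltnNge ltnW ?ltn_addr.
Qed.

Lemma block_op_skew : block_op false (fun m n s t => perm (@skew_fun_inj m n s t)).
Proof.
move=> m n s t; split=> i j; rewrite !permE /skew_fun;
  rewrite ?split_lshift ?split_rshift ?ltn_add2l //=.
  by rewrite ltnNge ltnW ?ltn_addr.
by rewrite ltn_addr.
Qed.

Lemma embedding_comp s p q f g :
  embedding (s := s) (p := p) f -> embedding (s := p) (p := q) g ->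
  embedding (s := s) (p := q) (g \o f).
Proof.
move=> [f_pos f_val] [g_pos g_val]; split=> i j /=; last by rewrite f_val g_val.
by move=> /f_pos /g_pos.
Qed.

Lemma preorder_lcontained L (leL : L -> L -> Prop) :
  PreOrder leL -> PreOrder (lcontained leL).
Proof.
move=> preL; split.
  by move=> s; exists id; split=> // j; exact: (@PreOrder_Reflexive _ leL).
move=> s p q [f [f_emb fL]] [g [g_emb gL]]; exists (g \o f).
split; first exact: embedding_comp f_emb g_emb.
by move=> j; exact: (@PreOrder_Transitive _ leL) (fL j) (gL (f j)).
Qed.

Section BlockOp.
Variables (up : bool) (op : forall m n, 'S_m -> 'S_n -> 'S_(m + n)).
Hypothesis opP : block_op up op.

Let pop (s t : permutation) : permutation := mkperm (op (pperm s) (pperm t)).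

Definition block_map m n m' n' (f : 'I_m -> 'I_m') (g : 'I_n -> 'I_n') (i : 'I_(m + n)) :
    'I_(m' + n') :=
  match split i with inl a => lshift n' (f a) | inr b => rshift m' (g b) end.

Lemma embedding_block_map s s' t t' f g :
  embedding (s := s) (p := s') f -> embedding (s := t) (p := t') g ->
  embedding (s := pop s t) (p := pop s' t') (block_map f g).
Proof.
move=> [f_pos f_val] [g_pos g_val].
have [ll rr lr rl] := opP (pperm s) (pperm t).
have [ll' rr' lr' rl'] := opP (pperm s') (pperm t').
split=> i j; rewrite /block_map;
  case: (split_ordP i) => a ->; case: (split_ordP j) => b -> /=.
- exact: f_pos.
- by move=> _; have := ltn_ord (f a); lia.
- by have := ltn_ord b; lia.
- by rewrite !ltn_add2l; exact: g_pos.
- by rewrite ll ll'.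
- by rewrite lr lr'.
- by rewrite rl rl'.
- by rewrite rr rr'.
Qed.

Lemma embedding_lshift s t :
  embedding (s := s) (p := pop s t) (@lshift (plength s) (plength t)).
Proof. by have [ll _ _ _] := opP (pperm s) (pperm t); split=> i j //=; rewrite ll. Qed.

Lemma embedding_rshift s t :
  embedding (s := t) (p := pop s t) (@rshift (plength s) (plength t)).
Proof.
have [_ rr _ _] := opP (pperm s) (pperm t).
by split=> i j /=; rewrite ?ltn_add2l ?rr.
Qed.

(** * Splitting a permutation contained in a block operation *)

Lemma initial_segment n (P : pred 'I_n) :
  (forall i j : 'I_n, i < j -> P j -> P i) ->
  exists2 m, m <= n & forall i : 'I_n, P i = (i < m).
Proof.
elim: n P => [|n IH] P downP; first by exists 0 => // -[].
have [Pmax|nPmax] := boolP (P ord_max).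
  exists n.+1 => // i; rewrite ltn_ord.
  have := ltn_ord i; rewrite ltnS leq_eqVlt => /predU1P [eq_i|lt_i].
    by rewrite (_ : i = ord_max) //; exact: val_inj.
  exact: downP Pmax.
have [m le_mn mP] := IH (fun i => P (widen_ord (leqnSn n) i))
  (fun i j lt_ij => downP (widen_ord _ i) (widen_ord _ j) lt_ij).
exists m => [|i]; first exact: leqW.
have := ltn_ord i; rewrite ltnS leq_eqVlt => /predU1P [eq_i|lt_i].
  by rewrite (_ : i = ord_max) ?(negbTE nPmax) /=; [lia | exact: val_inj].
by rewrite -[RHS](mP (Ordinal lt_i)); congr P; exact: val_inj.
Qed.

(** The positions of [s] sent into the block of [a] form an initial segment. Cutting [s] there and
    standardizing both pieces gives [s1] and [s2]. *)
Lemma contained_block s a b : contained s (pop a b) ->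
  exists s1 s2, [/\ s = pop s1 s2, contained s1 a & contained s2 b].
Proof.
case: s => k s [f [f_pos f_val]]; rewrite /plength /pperm /= in f f_pos f_val *.
have [|m le_mk mP] := @initial_segment k (fun i => f i < plength a).
  by move=> i j /f_pos; exact: ltn_trans.
(* The length [k] is replaced by [m + n], so that [s] has the type of a block operation. *)
move: (subnKC le_mk) => eq_k; move: (k - m) eq_k => n eq_k.
subst k => {le_mk}.
have [ll rr lr rl] := opP (pperm a) (pperm b).
have fl i : exists a0, f (lshift n i) = lshift (plength b) a0.
  have := mP (lshift n i); rewrite /= ltn_ord.
  by case: (split_ordP (f (lshift n i))) => c -> /=; [exists c | lia].
have fr i : exists b0, f (rshift m i) = rshift (plength a) b0.
  have := mP (rshift m i); case: (split_ordP (f (rshift m i))) => c -> /=.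
    lia.
  by exists c.
have [f1 f1P] := choice fl; have [f2 f2P] := choice fr.
have [|s1 s1P] := @standardize m (fun i => s (lshift n i)).
  by move=> i j /val_inj /perm_inj /lshift_inj.
have [|s2 s2P] := @standardize n (fun i => s (rshift m i)).
  by move=> i j /val_inj /perm_inj /rshift_inj.
exists (mkperm s1), (mkperm s2); split.
(* Within a block [s1] and [s2] copy the order of [s]; across blocks the order in [s], read through
   [f], is the one forced by [up]. *)
- congr existT; apply: order_isomorphic_perm_eq => i j.
  have [ll' rr' lr' rl'] := opP s1 s2.
  case: (split_ordP i) => c ->; case: (split_ordP j) => d -> /=.
  + by rewrite ll' s1P.
  + by rewrite lr' f_val f1P f2P lr.
  + by rewrite rl' f_val f1P f2P rl.
  + by rewrite rr' s2P.
- exists f1; split=> i j; first by move=> /(f_pos (lshift n i) (lshift n j)); rewrite !f1P.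
  by rewrite /= s1P f_val !f1P ll.
- exists f2; split=> i j.
    by have := f_pos (rshift m i) (rshift m j); rewrite !f2P /= !ltn_add2l.
  by rewrite /= s2P f_val !f2P rr.
Qed.

Lemma perm_class_generated C : perm_class C -> perm_class (generated pop C).
Proof.
move=> hC s p sp gen_p; elim: gen_p s sp => {p} [p Cp|p q _ IHp _ IHq] s sp.
  by apply: generated_base; exact: hC Cp.
have [s1 [s2 [-> le1 le2]]] := contained_block sp.
by apply: generated_op; [exact: IHp | exact: IHq].
Qed.

(** The generated set is itself a class closed under the operation, so it contains the smallest one.
    This inclusion suffices because wqo passes to subsets. *)
Lemma closure_generated C : perm_class C ->
  (smallest [set D | perm_class D /\ closed_under pop D] C `<=` generated pop C)%classic.
Proof.
move=> hC; apply: smallest_sub; last by move=> p; exact: generated_base.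
by split; [exact: perm_class_generated | move=> s t; exact: generated_op].
Qed.

(** * Labelled block operations *)

Section Labelled.
Variables (L : Type) (leL : L -> L -> Prop).
Hypothesis preL : PreOrder leL.

Definition lop (s t : lperm L) : lperm L :=
  LPerm (lperm_perm := pop (lperm_perm s) (lperm_perm t))
    (fun i => match split i with
              | inl a => lperm_label s a
              | inr b => lperm_label t b
              end).

Lemma lop_mono s s' t t' :
  lcontained leL s s' -> lcontained leL t t' ->
  lcontained leL (lop s t) (lop s' t').
Proof.
move=> [f [f_emb fL]] [g [g_emb gL]]; exists (block_map f g).
split; first exact: embedding_block_map.
move=> j; rewrite /= /block_map.
by case: (split_ordP j) => a _; rewrite ?split_lshift ?split_rshift.
Qed.

Lemma lop_gel s t : lcontained leL s (lop s t).
Proof.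
exists (@lshift _ _); split; first exact: embedding_lshift.
by move=> j; rewrite /= split_lshift; exact: (@PreOrder_Reflexive _ leL).
Qed.

Lemma lop_ger s t : lcontained leL t (lop s t).
Proof.
exists (@rshift _ _); split; first exact: embedding_rshift.
by move=> j; rewrite /= split_rshift; exact: (@PreOrder_Reflexive _ leL).
Qed.

Lemma generated_labelled C (p : lperm L) :
  generated pop C (lperm_perm p) -> generated lop (labelled C L) p.
Proof.
case: p => p l /= gen_p; elim: gen_p l => {p} [p Cp|p q _ IHp _ IHq] l.
  exact: generated_base.
(* A labelling of a block operation is the pair of its restrictions to the blocks, which is why the
   induction ranges over all labellings [l]. *)
suff -> : LPerm l = lop (LPerm (l \o @lshift _ _)) (LPerm (l \o @rshift _ _)).
  by apply: generated_op; [exact: IHp | exact: IHq].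
congr LPerm; apply: funext => i /=.
by case: (split_ordP i) => a ->.
Qed.

Lemma wqo_labelled_closure C : perm_class C ->
  wqo_on (labelled C L) (lcontained leL) ->
  wqo_on (labelled (smallest [set D | perm_class D /\ closed_under pop D]%classic C) L)
    (lcontained leL).
Proof.
move=> hC; apply: (wqo_generated (op := lop)).
- exact: preorder_lcontained.
- exact: lop_mono.
- exact: lop_gel.
- exact: lop_ger.
- by move=> p /(closure_generated hC); exact: generated_labelled.
Qed.

End Labelled.

End BlockOp.

(** * Reduction of wqo to a single label, and the conclusion *)

Lemma wqo_unlabelled (X : set permutation) :
  wqo_on X contained <->
  wqo_on (labelled X unit) (lcontained (fun _ _ => True)).
Proof.
have pre : PreOrder contained.
  split; first by move=> s; exists id.
  by move=> s p q [f f_emb] [g g_emb]; exists (g \o f); exact: embedding_comp f_emb g_emb.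
have preL : PreOrder (lcontained (fun _ _ : unit => True)).
  exact: preorder_lcontained.
split=> -[_ goodX]; (split; first exact: preorder_on) => y.
  have [i [j [lt_ij [f f_emb]]]] := goodX (fun n => exist X _ (proj2_sig (y n))).
  by exists i, j; split=> //; exists f.
have [i [j [lt_ij [f [f_emb _]]]]] := goodX (fun n =>
  exist (labelled X unit) (LPerm (fun=> tt)) (proj2_sig (y n))).
by exists i, j; split=> //; exists f.
Qed.

Theorem theorem6p2 (C : set permutation) (hC : perm_class C) :
  (wqo_on C contained ->
     wqo_on (sum_closure C) contained /\ wqo_on (skew_closure C) contained) /\
  (lwqo C -> lwqo (sum_closure C) /\ lwqo (skew_closure C)).
Proof.
split=> [/wqo_unlabelled wqoC|lwqoC].
  by split; apply/wqo_unlabelled;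
    [apply: (wqo_labelled_closure block_op_sum) | apply: (wqo_labelled_closure block_op_skew)].
split=> L leL wqoL; have [preL _] := wqoL; have := lwqoC L leL wqoL.
  exact: (wqo_labelled_closure block_op_sum).
exact: (wqo_labelled_closure block_op_skew).
Qed.
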